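(* Let $L\subseteq\mathcal{L}$ be a finite signature, $h\in L$ and $i\in\mathbb{I}(L)$. Then \[\sigma_{|L\setminus\{h\}}(\mathsf{rmv}_h(i))=\mathsf{rmv}_h(\sigma_{|L}(i)).\]
   Context: Fix a universe $\mathcal{L}$ of lifelines and a universe $\mathcal{M}$ of messages. For $l\in\mathcal{L}$, the set of actions over $l$ is $\mathbb{A}_l=\{l!m,\ l?m \mid m\in\mathcal{M}\}$, and for $a\in\mathbb{A}_l$ one writes $\theta(a)=l$. The set of traces over $l$ is $\mathbb{T}_l=\mathbb{A}_l^*$, the finite words over $\mathbb{A}_l$, with empty word $\varepsilon$ and concatenation ''$.$''. For a finite $L\subseteq\mathcal{L}$ (a signature), $\mathbb{A}(L)=\bigcup_{l\in L}\mathbb{A}_l$. The set of multi-traces over $L$ is $\mathbb{M}(L)=\prod_{l\in L}\mathbb{T}_l$; $\mu_{|l}$ denotes the $l$-component of $\mu$, and $\varepsilon_L$ is the multi-trace all of whose components are $\varepsilon$. For $a\in\mathbb{A}(L)$ and $\mu\in\mathbb{M}(L)$, $a\,\hat{}\,\mu$ is the multi-trace obtained from $\mu$ by replacing the component on $\theta(a)$ with $a.\mu_{|\theta(a)}$. Operations on multi-traces: - $\mu_1\cup\mu_2=\{\mu_1,\mu_2\}$. - $\mu_1;\mu_2$ is the multi-trace whose $l$-component is $\mu_{1|l}.\mu_{2|l}$ for every $l\in L$. - $\mu_1\,||\,\mu_2$ is the set of multi-traces $\mu$ such that, for every $l\in L$, $\mu_{|l}$ is an interleaving (shuffle) of $\mu_{1|l}$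 and $\mu_{2|l}$. These operations are extended to sets by $T_1\diamond T_2=\bigcup_{\mu_1\in T_1,\mu_2\in T_2}(\mu_1\diamond\mu_2)$, treating a single multi-trace as a singleton. For $\diamond\in\{;,||\}$, $T^{\diamond *}=\bigcup_{j\in\mathbb{N}}T^{\diamond j}$, where $T^{\diamond 0}=\{\varepsilon_L\}$ and $T^{\diamond j}=T\diamond T^{\diamond(j-1)}$. Removal on multi-traces: for $h\in L$, $\mathsf{rmv}_h:\mathbb{M}(L)\to\mathbb{M}(L\setminus\{h\})$ is given by $\mathsf{rmv}_h(\mu)=(\mu_{|l})_{l\in L\setminus\{h\}}$. It is extended to sets of multi-traces elementwise. Interactions: $\mathbb{I}(L)$ is the set of ground terms built from the constants $\varnothing$ (the empty interaction) and $a\in\mathbb{A}(L)$, the unary operators $loop_S$ and $loop_P$, and the binary operators $seq$, $par$ and $alt$. Semantics: $\sigma_{|L}:\mathbb{I}(L)\to\mathcal{P}(\mathbb{M}(L))$ is defined inductively by - $\sigma_{|L}(\varnothing)=\{\varepsilon_L\}$ and $\sigma_{|L}(a)=\{a\,\hat{}\,\varepsilon_L\}$; - $\sigma_{|L}(seq(i_1,i_2))=\sigma_{|L}(i_1);\sigma_{|L}(i_2)$, $\sigma_{|L}(par(i_1,i_2))=\sigma_{|L}(i_1)\,||\,\sigma_{|L}(i_2)$, and $\sigma_{|L}(alt(i_1,i_2))=\sigma_{|L}(i_1)\cup\sigma_{|L}(i_2)$; - $\sigma_{|L}(loop_S(i))=\sigma_{|L}(i)^{;*}$ and $\sigma_{|L}(loop_P(i))=\sigma_{|L}(i)^{||*}$.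 Removal on interactions: $\mathsf{rmv}_h:\mathbb{I}(L)\to\mathbb{I}(L\setminus\{h\})$ is defined by - $\mathsf{rmv}_h(\varnothing)=\varnothing$; - $\mathsf{rmv}_h(a)=\varnothing$ if $\theta(a)=h$, and $\mathsf{rmv}_h(a)=a$ otherwise; - $\mathsf{rmv}_h(f(i_1,i_2))=f(\mathsf{rmv}_h(i_1),\mathsf{rmv}_h(i_2))$ for $f\in\{seq,alt,par\}$; - $\mathsf{rmv}_h(loop_k(i_1))=loop_k(\mathsf{rmv}_h(i_1))$ for $k\in\{S,P\}$. *)

(* Defs.v *)
From HB Require Import structures.
From mathcomp Require Import all_boot finmap.
From mathcomp Require Import boolp classical_sets.

Set Implicit Arguments.
Unset Strict Implicit.
Unset Printing Implicit Defensive.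

Local Open Scope classical_set_scope.

Section Actions.
Variables (Lifeline : choiceType) (Message : Type).

Inductive action : Type :=
| Emit of Lifeline & Message     (* l!m *)
| Receive of Lifeline & Message. (* l?m *)

Definition theta (a : action) : Lifeline :=
  match a with Emit l _ => l | Receive l _ => l end.

Definition action_at (l : Lifeline) : Type := {a : action | theta a == l}.

Definition trace (l : Lifeline) : Type := seq (action_at l).

Definition action_in (L : {fset Lifeline}) : Type :=
  {a : action | theta a \in L}.

Definition multitrace (L : {fset Lifeline}) : Type :=
  forall l : L, trace (val l).

End Actions.

Inductive interleaving (T : Type) : seq T -> seq T -> seq T -> Prop :=
| interleaving_nil : interleaving [::] [::] [::]
| interleaving_l x s1 s2 s :
    interleaving s1 s2 s -> interleaving (x :: s1) s2 (x :: s)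
| interleaving_r x s1 s2 s :
    interleaving s1 s2 s -> interleaving s1 (x :: s2) (x :: s).

Section Multitraces.
Variables (Lifeline : choiceType) (Message : Type) (L : {fset Lifeline}).
Local Notation mtrace := (multitrace Message L).

Definition mt_empty : mtrace := fun _ => [::].

(* [insub (val a) : option (action_at _ (val l))] is [Some] of a itself
   exactly when theta a = l. *)
Definition mt_cons (a : action_in Message L) (mu : mtrace) : mtrace :=
  fun l =>
    if (insub (val a) : option (action_at Message (val l))) is Some b
    then b :: mu l else mu l.

Definition mt_alt (mu1 mu2 : mtrace) : set mtrace := [set mu1; mu2].

Definition mt_seq (mu1 mu2 : mtrace) : set mtrace :=
  [set (fun l => mu1 l ++ mu2 l) : mtrace].

Definition mt_par (mu1 mu2 : mtrace) : set mtrace :=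
  [set mu | forall l : L, interleaving (mu1 l) (mu2 l) (mu l)].

Definition lift_op (op : mtrace -> mtrace -> set mtrace)
    (T1 T2 : set mtrace) : set mtrace :=
  \bigcup_(mu1 in T1) \bigcup_(mu2 in T2) op mu1 mu2.

Definition op_power (op : mtrace -> mtrace -> set mtrace)
    (T : set mtrace) (j : nat) : set mtrace :=
  iter j (lift_op op T) [set mt_empty].

Definition op_star (op : mtrace -> mtrace -> set mtrace)
    (T : set mtrace) : set mtrace :=
  \bigcup_j op_power op T j.

Inductive interaction : Type :=
| IEmpty
| IAct of action_in Message L
| ISeq of interaction & interaction
| IPar of interaction & interaction
| IAlt of interaction & interaction
| ILoopS of interaction
| ILoopP of interaction.

Fixpoint sigma (i : interaction) : set mtrace :=
  match i with
  | IEmpty => [set mt_empty]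
  | IAct a => [set mt_cons a mt_empty]
  | ISeq i1 i2 => lift_op mt_seq (sigma i1) (sigma i2)
  | IPar i1 i2 => lift_op mt_par (sigma i1) (sigma i2)
  | IAlt i1 i2 => lift_op mt_alt (sigma i1) (sigma i2)
  | ILoopS i1 => op_star mt_seq (sigma i1)
  | ILoopP i1 => op_star mt_par (sigma i1)
  end.

End Multitraces.

Arguments mt_empty {Lifeline Message L}.
Arguments IEmpty {Lifeline Message L}.

Section Removal.
Variables (Lifeline : choiceType) (Message : Type) (L : {fset Lifeline}).
Variable h : Lifeline.

Definition rmv_mt (mu : multitrace Message L) : multitrace Message (L `\ h)%fset :=
  fun l => mu (fincl (fsubD1set L h) l).

Lemma action_in_rmv (a : action_in Message L) :
  theta (val a) <> h -> theta (val a) \in (L `\ h)%fset.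
Proof. by move/eqP=> ne; rewrite in_fsetD1 ne; exact: (valP a). Qed.

Fixpoint rmv (i : interaction Message L) : interaction Message (L `\ h)%fset :=
  match i with
  | IEmpty => IEmpty
  | IAct a =>
      match @eqP _ (theta (val a)) h with
      | ReflectT _ => IEmpty
      | ReflectF ne => IAct (exist _ (val a) (action_in_rmv ne))
      end
  | ISeq i1 i2 => ISeq (rmv i1) (rmv i2)
  | IPar i1 i2 => IPar (rmv i1) (rmv i2)
  | IAlt i1 i2 => IAlt (rmv i1) (rmv i2)
  | ILoopS i1 => ILoopS (rmv i1)
  | ILoopP i1 => ILoopP (rmv i1)
  end.

End Removal.

Arguments rmv_mt {Lifeline Message L} h mu.
Arguments rmv {Lifeline Message L} h i.

(* Main.v *)
Require Import Defs.
From HB Require Import structures.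
From mathcomp Require Import all_boot finmap.
From mathcomp Require Import boolp classical_sets.

(** Removal on multi-traces is a homomorphism for each of the three operations,
    hence it commutes with their liftings to sets, with iterated powers and with
    Kleene stars; the theorem follows by induction on the interaction.  The only
    operation for which this is not a computation is the parallel one: an
    interleaving of the removed multi-traces has to be completed on [h], where
    the concatenation of the two components is a possible interleaving. *)

Local Open Scope classical_set_scope.

Lemma interleaving_cat (T : Type) (s1 s2 : seq T) :
  interleaving s1 s2 (s1 ++ s2).
Proof.
elim: s1 => [|x s1 IH] /=; last exact: interleaving_l.
elim: s2 => [|x s2 IH]; [exact: interleaving_nil | exact: interleaving_r].
Qed.

Section Removal.
Variables (Lifeline : choiceType) (Message : Type) (L : {fset Lifeline}).
Variable h : Lifeline.
Local Notation mtrace := (multitrace Message L).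
Local Notation mtrace_h := (multitrace Message (L `\ h)%fset).

(** For each fixed [dflt], a section of [rmv_mt h]. Matching on [idP] yields the membership proof
    needed to index [nu]. *)
Definition extend_mt (nu : mtrace_h) (dflt : mtrace) : mtrace :=
  fun l => match @idP (val l \in (L `\ h)%fset) with
           | ReflectT p => nu [` p]%fset
           | ReflectF _ => dflt l
           end.

Lemma extend_mtK (nu : mtrace_h) (dflt : mtrace) :
  rmv_mt h (extend_mt nu dflt) = nu.
Proof.
apply: functional_extensionality_dep => -[l lP].
rewrite /rmv_mt /extend_mt /=.
by case: {-}_ / idP => [p|/(_ lP)//]; rewrite (bool_irrelevance p lP).
Qed.

Lemma rmv_mt_seq (mu1 mu2 : mtrace) :
  rmv_mt h @` mt_seq mu1 mu2 = mt_seq (rmv_mt h mu1) (rmv_mt h mu2).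
Proof. by rewrite /mt_seq image_set1. Qed.

Lemma rmv_mt_alt (mu1 mu2 : mtrace) :
  rmv_mt h @` mt_alt mu1 mu2 = mt_alt (rmv_mt h mu1) (rmv_mt h mu2).
Proof. by rewrite /mt_alt image_setU !image_set1. Qed.

Lemma rmv_mt_par (mu1 mu2 : mtrace) :
  rmv_mt h @` mt_par mu1 mu2 = mt_par (rmv_mt h mu1) (rmv_mt h mu2).
Proof.
apply/seteqP; split=> [_ [mu mu_par <-] l|nu nu_par].
  exact: (mu_par (fincl (fsubD1set L h) l)).
exists (extend_mt nu (fun l => mu1 l ++ mu2 l)); last exact: extend_mtK.
case=> l lL; rewrite /extend_mt /=.
case: {-}_ / idP => [p|_]; last exact: interleaving_cat.
(* Away from [h], [nu_par] applies up to the proof of membership in [L], which [fincl] rebuilds. *)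
have := nu_par [` p]%fset; rewrite /rmv_mt /fincl /=.
by rewrite (bool_irrelevance (fsubsetP _ _ _) lL).
Qed.

(** Holds by conversion: [mt_cons] inspects only [val a] and [val l]. *)
Lemma rmv_mt_cons (a : action_in Message L) (ne : theta (val a) <> h)
    (mu : mtrace) :
  rmv_mt h (mt_cons a mu) =
  mt_cons (exist _ (val a) (action_in_rmv ne)) (rmv_mt h mu).
Proof. by []. Qed.

Lemma rmv_mt_cons_removed (a : action_in Message L) (mu : mtrace) :
  theta (val a) = h -> rmv_mt h (mt_cons a mu) = rmv_mt h mu.
Proof.
move=> ah; apply: functional_extensionality_dep => -[l lP].
(* Every remaining lifeline differs from [h], so the [insub] test fails. *)
rewrite /rmv_mt /mt_cons insubN //= ah.
by move: lP; rewrite in_fsetD1 eq_sym => /andP[].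
Qed.

Section Lifting.
Variable op : mtrace -> mtrace -> set mtrace.
Variable op_h : mtrace_h -> mtrace_h -> set mtrace_h.
Hypothesis rmv_mt_op : forall mu1 mu2,
  rmv_mt h @` op mu1 mu2 = op_h (rmv_mt h mu1) (rmv_mt h mu2).

(** Direct images commute with unions, and a union over an image reindexes over the original set,
    which leaves [rmv_mt_op] for a single pair. *)
Lemma rmv_mt_lift_op (T1 T2 : set mtrace) :
  rmv_mt h @` lift_op op T1 T2 =
  lift_op op_h (rmv_mt h @` T1) (rmv_mt h @` T2).
Proof.
rewrite /lift_op image_bigcup bigcup_image; apply: eq_bigcupr => mu1 _.
rewrite image_bigcup bigcup_image; apply: eq_bigcupr => mu2 _.
exact: rmv_mt_op.
Qed.

Lemma rmv_mt_op_star (T : set mtrace) :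
  rmv_mt h @` op_star op T = op_star op_h (rmv_mt h @` T).
Proof.
rewrite /op_star image_bigcup; apply: eq_bigcupr => j _.
(* At exponent zero, removal sends [mt_empty] to [mt_empty] by conversion. *)
elim: j => [|j IH]; first by rewrite /op_power /= image_set1.
by rewrite /op_power !iterS rmv_mt_lift_op -/(op_power _ _ _) IH.
Qed.

End Lifting.
End Removal.

Theorem theorem1 (Lifeline : choiceType) (Message : Type)
    (L : {fset Lifeline}) (h : Lifeline) (hL : h \in L)
    (i : interaction Message L) :
  sigma (rmv h i) = rmv_mt h @` sigma i.
Proof.
elim: i => [|a|i1 IH1 i2 IH2|i1 IH1 i2 IH2|i1 IH1 i2 IH2|i IH|i IH] /=.
- by rewrite image_set1.
- rewrite image_set1; case: eqP => [ah|ne] /=.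
    by rewrite rmv_mt_cons_removed.
  by rewrite rmv_mt_cons.
- by rewrite IH1 IH2 (rmv_mt_lift_op _ _ _ _ _ _ (@rmv_mt_seq _ _ _ _)).
- by rewrite IH1 IH2 (rmv_mt_lift_op _ _ _ _ _ _ (@rmv_mt_par _ _ _ _)).
- by rewrite IH1 IH2 (rmv_mt_lift_op _ _ _ _ _ _ (@rmv_mt_alt _ _ _ _)).
- by rewrite IH (rmv_mt_op_star _ _ _ _ _ _ (@rmv_mt_seq _ _ _ _)).
- by rewrite IH (rmv_mt_op_star _ _ _ _ _ _ (@rmv_mt_par _ _ _ _)).
Qed.
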